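(* For every even integer $n\ge2$, $$\frac{2n\ln2}{\pi}+\frac{\pi}{12n}-\frac{7\pi^3}{1440\,n^3}<\sum_{l=1}^{n-1}(-1)^{l+1}\csc\frac{\pi l}{n}<\frac{2n\ln2}{\pi}+\frac{\pi}{12n}.$$ For every odd integer $n\ge3$, $\sum_{l=1}^{n-1}(-1)^{l+1}\csc\frac{\pi l}{n}=0$. *)

(* Defs.v *)
From Stdlib Require Import Reals.
From Coquelicot Require Import Coquelicot.

Open Scope R_scope.

(* Since [/ 0] is unspecified in Stdlib, [csc x] is meaningful only when
   [sin x <> 0]. *)
Definition csc (x : R) : R := / sin x.

(* The arguments [PI * l / n] with [1 <= l <= n - 1] lie strictly between 0
   and [PI], so every term is well defined; [n - 1] is truncated subtraction,
   exact for [1 <= n]. *)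
Definition alternating_csc_sum (n : nat) : R :=
  sum_n_m (fun l : nat => (-1) ^ (l + 1) * csc (PI * INR l / INR n)) 1 (n - 1).

(* Main.v *)
(* For even [n], [csc x = cot (x/2) - cot x] and the symmetry [l -> n - l] turn
   the sum into the alternating sum of [cot (l h)] with [h = PI / (2n)]. Split
   [cot x = 1/x - g x]. The alternating sum of [1/l] is compared with [ln 2] by
   the monotonicity in [n] of suitably corrected partial sums. The alternating
   sum of [g (l h)] is compared with its Boole summation formula
     [(g(0) - g(nh))/2 - h/4 (g'(0) - g'(nh)) + h^3/48 (g'''(0) - g'''(nh)) - ...],
   whose truncations are alternately too large and too small. To avoid
   the removable singularity of [g] at [0], the comparison is proved
   for [tan], whose derivatives are polynomials in [tan], and transferred by
   [g x = g (x/2) / 2 + tan (x/2) / 2]: the error [e] for [g] satisfies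
   [e h < e (h/2) / 2] and [x e(x) -> 0] at [0], hence [e h < 0].
   In the final bounds the contributions of [1/x] at [x = nh] cancel. *)
Require Import Defs.
From Stdlib Require Import Reals Lra Lia.
From Coquelicot Require Import Coquelicot.

Open Scope R_scope.

(** * Boole's formula over one pair of steps *)

Lemma pos_of_derive_pos (F F' : R -> R) (h : R) :
  0 < h -> F 0 = 0 ->
  (forall s, 0 <= s <= h -> is_derive F s (F' s)) ->
  (forall s, 0 < s < h -> 0 < F' s) ->
  0 < F h.
Proof.
  intros Hh F0 HF Hpos.
  destruct (MVT_cor2 F F' 0 h Hh) as [c [Hc Hc']].
  { intros c Hc. apply is_derive_Reals. now apply HF. }
  specialize (Hpos c Hc'). rewrite F0 in Hc.
  nra.
Qed.

Section BoolePair.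

Variables (f : nat -> R -> R) (y h : R).
Hypothesis h_pos : 0 < h.

(* [P' k = M (k+1)], [M' k = P (k+1)], and [M] vanishes at [0]; the estimates
   below follow by differentiating twice in the step [s]. *)
Let P (k : nat) (s : R) : R := f k (y + s) + f k (y - s).
Let M (k : nat) (s : R) : R := f k (y + s) - f k (y - s).

Hypothesis f_derive : forall k s, (k < 5)%nat -> y - h <= s <= y + h ->
  is_derive (f k) s (f (S k) s).

Lemma even_part_derive (k : nat) (s : R) : (k < 5)%nat -> 0 <= s <= h ->
  is_derive (P k) s (M (S k) s).
Proof.
  intros Hk Hs. unfold P, M.
  assert (Hp := f_derive k (y + s) Hk ltac:(lra)).
  assert (Hm := f_derive k (y - s) Hk ltac:(lra)).
  auto_derive.
  - split; [now exists (f (S k) (y + s))|]. split; [now exists (f (S k) (y - s))|exact I].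
  - replace (y + - s) with (y - s) by ring.
    erewrite (is_derive_unique (fun x => f k x)) by exact Hp.
    erewrite (is_derive_unique (fun x => f k x)) by exact Hm. ring.
Qed.

Lemma odd_part_derive (k : nat) (s : R) : (k < 5)%nat -> 0 <= s <= h ->
  is_derive (M k) s (P (S k) s).
Proof.
  intros Hk Hs. unfold P, M.
  assert (Hp := f_derive k (y + s) Hk ltac:(lra)).
  assert (Hm := f_derive k (y - s) Hk ltac:(lra)).
  auto_derive.
  - split; [now exists (f (S k) (y + s))|]. split; [now exists (f (S k) (y - s))|exact I].
  - replace (y + - s) with (y - s) by ring.
    erewrite (is_derive_unique (fun x => f k x)) by exact Hp.
    erewrite (is_derive_unique (fun x => f k x)) by exact Hm. ring.
Qed.

(** With [s] for [h], the right side minus the left is [s/4 * M 1 s - P 0 s / 2 + f 0 y]. It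
    vanishes at [s = 0], and so does its derivative [s/4 * P 2 s - M 1 s / 4], whose own derivative
    [s/4 * M 3 s] is positive because [f 3] increases. *)
Lemma boole_pair_upper :
  (forall s t, y - h <= s -> s < t -> t <= y + h -> f 3 s < f 3 t) ->
  f 0%nat (y - h) - f 0%nat y
  < (f 0%nat (y - h) - f 0%nat (y + h)) / 2 - h / 4 * (f 1%nat (y - h) - f 1%nat (y + h)).
Proof.
  intros f3_incr.
  assert (D1 : forall s, 0 < s <= h -> 0 < s / 4 * P 2 s - M 1 s / 4).
  { intros t Ht.
    apply (pos_of_derive_pos (fun s => s / 4 * P 2 s - M 1 s / 4)
             (fun s => s / 4 * M 3 s)); try lra.
    - unfold M. rewrite Rplus_0_r, Rminus_0_r. field.
    - intros s Hs.
      assert (H2 := even_part_derive 2 s ltac:(lia) ltac:(lra)).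
      assert (H1 := odd_part_derive 1 s ltac:(lia) ltac:(lra)).
      auto_derive.
      + split; [now exists (M 3 s)|]. split; [now exists (P 2 s)|exact I].
      + erewrite (is_derive_unique (fun x => P 2 x)) by exact H2.
        erewrite (is_derive_unique (fun x => M 1 x)) by exact H1. lra.
    - intros s Hs. unfold M.
      assert (f 3%nat (y - s) < f 3%nat (y + s)) by (apply f3_incr; lra).
      apply Rmult_lt_0_compat; lra. }
  assert (0 < h / 4 * M 1 h - P 0 h / 2 + f 0%nat y); [|unfold P, M in *; lra].
  apply (pos_of_derive_pos (fun s => s / 4 * M 1 s - P 0 s / 2 + f 0%nat y)
           (fun s => s / 4 * P 2 s - M 1 s / 4)); try lra.
  - unfold P. rewrite Rplus_0_r, Rminus_0_r. field.
  - intros s Hs.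
    assert (H2 := even_part_derive 0 s ltac:(lia) ltac:(lra)).
    assert (H1 := odd_part_derive 1 s ltac:(lia) ltac:(lra)).
    auto_derive.
    + split; [now exists (P 2 s)|]. split; [now exists (M 1 s)|exact I].
    + erewrite (is_derive_unique (fun x => P 0 x)) by exact H2.
      erewrite (is_derive_unique (fun x => M 1 x)) by exact H1. lra.
  - intros s Hs. apply D1. lra.
Qed.

(** With the [f 3] term included, the second derivative of the right side minus the left is [s/8 *
    (s * P 4 s - M 3 s) + s^3/48 * M 5 s]. The bracket vanishes at [0] and has derivative
    [s * M 5 s], so everything reduces to [M 5 > 0]. *)
Lemma boole_pair_lower :
  (forall s t, y - h <= s -> s < t -> t <= y + h -> f 5 s < f 5 t) ->
  (f 0%nat (y - h) - f 0%nat (y + h)) / 2 - h / 4 * (f 1%nat (y - h) - f 1%nat (y + h))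
    + h ^ 3 / 48 * (f 3%nat (y - h) - f 3%nat (y + h))
  < f 0%nat (y - h) - f 0%nat y.
Proof.
  intros f5_incr.
  assert (M5 : forall s, 0 < s <= h -> 0 < M 5 s).
  { intros s Hs. unfold M.
    assert (f 5%nat (y - s) < f 5%nat (y + s)) by (apply f5_incr; lra). lra. }
  assert (D3 : forall s, 0 < s <= h -> 0 < s * P 4 s - M 3 s).
  { intros t Ht.
    apply (pos_of_derive_pos (fun s => s * P 4 s - M 3 s) (fun s => s * M 5 s)); try lra.
    - unfold M. rewrite Rplus_0_r, Rminus_0_r. ring.
    - intros s Hs.
      assert (H2 := even_part_derive 4 s ltac:(lia) ltac:(lra)).
      assert (H1 := odd_part_derive 3 s ltac:(lia) ltac:(lra)).
      auto_derive.
      + split; [now exists (M 5 s)|]. split; [now exists (P 4 s)|exact I].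
      + erewrite (is_derive_unique (fun x => P 4 x)) by exact H2.
        erewrite (is_derive_unique (fun x => M 3 x)) by exact H1. ring.
    - intros s Hs. apply Rmult_lt_0_compat; [lra|apply M5; lra]. }
  assert (D1 : forall s, 0 < s <= h ->
    0 < M 1 s / 4 - s / 4 * P 2 s + s ^ 2 / 16 * M 3 s + s ^ 3 / 48 * P 4 s).
  { intros t Ht.
    apply (pos_of_derive_pos
             (fun s => M 1 s / 4 - s / 4 * P 2 s + s ^ 2 / 16 * M 3 s + s ^ 3 / 48 * P 4 s)
             (fun s => s / 8 * (s * P 4 s - M 3 s) + s ^ 3 / 48 * M 5 s)); try lra.
    - unfold M. rewrite Rplus_0_r, Rminus_0_r. field.
    - intros s Hs.
      assert (H1 := odd_part_derive 1 s ltac:(lia) ltac:(lra)).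
      assert (H2 := even_part_derive 2 s ltac:(lia) ltac:(lra)).
      assert (H3 := odd_part_derive 3 s ltac:(lia) ltac:(lra)).
      assert (H4 := even_part_derive 4 s ltac:(lia) ltac:(lra)).
      auto_derive.
      + repeat split; eexists; eassumption.
      + erewrite (is_derive_unique (fun x => M 1 x)) by exact H1.
        erewrite (is_derive_unique (fun x => P 2 x)) by exact H2.
        erewrite (is_derive_unique (fun x => M 3 x)) by exact H3.
        erewrite (is_derive_unique (fun x => P 4 x)) by exact H4. field.
    - intros s Hs.
      assert (A := D3 s ltac:(lra)). assert (B := M5 s ltac:(lra)).
      assert (0 < s ^ 3) by (apply pow_lt; lra).
      apply Rplus_lt_0_compat; apply Rmult_lt_0_compat; lra. }
  assert (0 < P 0 h / 2 - f 0%nat y - h / 4 * M 1 h + h ^ 3 / 48 * M 3 h);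
    [|unfold P, M in *; lra].
  apply (pos_of_derive_pos
           (fun s => P 0 s / 2 - f 0%nat y - s / 4 * M 1 s + s ^ 3 / 48 * M 3 s)
           (fun s => M 1 s / 4 - s / 4 * P 2 s + s ^ 2 / 16 * M 3 s + s ^ 3 / 48 * P 4 s));
    try lra.
  - unfold P. rewrite Rplus_0_r, Rminus_0_r. field.
  - intros s Hs.
    assert (H0 := even_part_derive 0 s ltac:(lia) ltac:(lra)).
    assert (H1 := odd_part_derive 1 s ltac:(lia) ltac:(lra)).
    assert (H3 := odd_part_derive 3 s ltac:(lia) ltac:(lra)).
    auto_derive.
    + repeat split; eexists; eassumption.
    + erewrite (is_derive_unique (fun x => P 0 x)) by exact H0.
      erewrite (is_derive_unique (fun x => M 1 x)) by exact H1.
      erewrite (is_derive_unique (fun x => M 3 x)) by exact H3. field.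
  - intros s Hs. apply D1. lra.
Qed.

End BoolePair.

(** * Alternating sums and their reflection *)

(** The index starts at [0], the left endpoint in Boole's formula. The concrete summands below,
    built from [tan], [cot], [csc], [cotrem] or [/ INR l], all vanish at [l = 0], by the default
    [/ 0 = 0] where necessary. *)
Fixpoint altsum (f : nat -> R) (n : nat) : R :=
  match n with
  | O => 0
  | S k => altsum f k + (-1) ^ k * f k
  end.

Lemma altsum_ext (f g : nat -> R) (n : nat) :
  (forall l, (l < n)%nat -> f l = g l) -> altsum f n = altsum g n.
Proof.
  induction n as [|n IH]; intros H; simpl; [reflexivity|].
  rewrite IH, H by (intros; try apply H; lia). reflexivity.
Qed.

Lemma altsum_linear (a b : R) (f g : nat -> R) (n : nat) :
  altsum (fun l => a * f l + b * g l) n = a * altsum f n + b * altsum g n.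
Proof. induction n as [|n IH]; simpl; [|rewrite IH]; ring. Qed.

Lemma altsum_head (f : nat -> R) (n : nat) :
  altsum f (S n) = f O - altsum (fun l => f (S l)) n.
Proof.
  induction n as [|n IH]; [simpl; ring|].
  change (altsum f (S (S n))) with (altsum f (S n) + (-1) ^ S n * f (S n)).
  rewrite IH. simpl. ring.
Qed.

(** Reversal turns the sign [(-1)^l] into [(-1)^(n-l)], hence the factor. The induction removes the
    first term on the left and the last one on the right. *)
Lemma altsum_rev (f : nat -> R) (n : nat) :
  altsum f (S n) = (-1) ^ n * altsum (fun l => f (n - l)%nat) (S n).
Proof.
  revert f. induction n as [|n IH]; intros f; [simpl; ring|].
  rewrite altsum_head, IH.
  change (altsum (fun l => f (S n - l)%nat) (S (S n)))
    with (altsum (fun l => f (S n - l)%nat) (S n) + (-1) ^ S n * f (S n - S n)%nat).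
  rewrite Nat.sub_diag, (altsum_ext (fun l => f (S n - l)%nat) (fun l => f (S (n - l)))).
  - assert (E : (-1) ^ n * (-1) ^ n = 1).
    { rewrite <- Rpow_mult_distr. replace (-1 * -1) with 1 by ring. apply pow1. }
    change ((-1) ^ S n) with (-1 * (-1) ^ n).
    set (u := (-1) ^ n) in *.
    transitivity (f O * (u * u) - u * altsum (fun l => f (S (n - l))) (S n));
      [rewrite E|]; ring.
  - intros l Hl. f_equal. lia.
Qed.

(** Since [f n = 0], the sum may be extended to the indices [0..n], a range stable under
    [l -> n - l]; reversal then equates it with its own negative. *)
Lemma altsum_antisym (f : nat -> R) (n : nat) :
  f n = 0 ->
  (forall l, (l <= n)%nat -> (-1) ^ n * f (n - l)%nat = - f l) ->
  altsum f n = 0.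
Proof.
  intros Hn Hf.
  assert (E := altsum_rev f n).
  (* The coefficient [0] and the zero function reduce linearity to plain scaling. *)
  assert (L := altsum_linear ((-1) ^ n) 0 (fun l => f (n - l)%nat) (fun _ => 0) (S n)).
  rewrite (altsum_ext _ (fun l => -1 * f l + 0 * f l) (S n)), altsum_linear in L.
  - replace ((-1) ^ n * altsum (fun l => f (n - l)%nat) (S n)) with (- altsum f (S n)) in E by lra.
    simpl in E. rewrite Hn in E. lra.
  - intros l Hl. rewrite Hf by lia. ring.
Qed.

(** * Boole's bounds for a sum of [2m] terms *)

(** The pair bound centred at [y = (2j+1)h] covers the terms [2j] and [2j+1]. Over all [j < m] the
    contributions of the inner even nodes telescope, leaving the ends [0] and [2mh]. *)
Lemma boole_upper (f : nat -> R -> R) (h b : R) (m : nat) :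
  0 < h -> (0 < m)%nat -> 2 * INR m * h <= b ->
  (forall k s, (k < 5)%nat -> 0 <= s <= b -> is_derive (f k) s (f (S k) s)) ->
  (forall s t, 0 <= s -> s < t -> t <= b -> f 3%nat s < f 3%nat t) ->
  altsum (fun l => f O (INR l * h)) (2 * m)
  < (f O 0 - f O (INR (2 * m) * h)) / 2
    - h / 4 * (f 1%nat 0 - f 1%nat (INR (2 * m) * h)).
Proof.
  intros Hh Hm Hb Hf Hincr.
  induction m as [|m IH]; [lia|].
  rewrite S_INR in Hb.
  assert (Hm0 := pos_INR m).
  assert (0 <= INR m * h) by nra.
  (* Weakened to [<=], the hypothesis also covers the empty sum, where both sides are [0]. *)
  assert (IH' : altsum (fun l => f O (INR l * h)) (2 * m)
    <= (f O 0 - f O (INR (2 * m) * h)) / 2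
       - h / 4 * (f 1%nat 0 - f 1%nat (INR (2 * m) * h))).
  { destruct m as [|m].
    - simpl. rewrite Rmult_0_l. lra.
    - apply Rlt_le, IH; [lia|lra]. }
  clear IH.
  assert (B := boole_pair_upper f (INR (2 * m) * h + h) h Hh).
  replace (2 * S m)%nat with (S (S (2 * m))) by lia.
  cbn [altsum]. rewrite !S_INR.
  replace ((-1) ^ S (2 * m)) with (-1) by (rewrite pow_1_odd; reflexivity).
  rewrite pow_1_even.
  replace ((INR (2 * m) + 1 + 1) * h) with (INR (2 * m) * h + h + h) by ring.
  replace ((INR (2 * m) + 1) * h) with (INR (2 * m) * h + h) by ring.
  replace (INR (2 * m) * h + h - h) with (INR (2 * m) * h) in B by ring.
  assert (E : INR (2 * m) * h = 2 * (INR m * h)) by (rewrite mult_INR; simpl; ring).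
  assert (B' := B ltac:(intros; apply Hf; [assumption|lra])
                  ltac:(intros; apply Hincr; lra)).
  lra.
Qed.

(** The same telescoping, starting from [boole_pair_lower]. *)
Lemma boole_lower (f : nat -> R -> R) (h b : R) (m : nat) :
  0 < h -> (0 < m)%nat -> 2 * INR m * h <= b ->
  (forall k s, (k < 5)%nat -> 0 <= s <= b -> is_derive (f k) s (f (S k) s)) ->
  (forall s t, 0 <= s -> s < t -> t <= b -> f 5%nat s < f 5%nat t) ->
  (f O 0 - f O (INR (2 * m) * h)) / 2
    - h / 4 * (f 1%nat 0 - f 1%nat (INR (2 * m) * h))
    + h ^ 3 / 48 * (f 3%nat 0 - f 3%nat (INR (2 * m) * h))
  < altsum (fun l => f O (INR l * h)) (2 * m).
Proof.
  intros Hh Hm Hb Hf Hincr.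
  induction m as [|m IH]; [lia|].
  rewrite S_INR in Hb.
  assert (Hm0 := pos_INR m).
  assert (0 <= INR m * h) by nra.
  assert (IH' : (f O 0 - f O (INR (2 * m) * h)) / 2
       - h / 4 * (f 1%nat 0 - f 1%nat (INR (2 * m) * h))
       + h ^ 3 / 48 * (f 3%nat 0 - f 3%nat (INR (2 * m) * h))
       <= altsum (fun l => f O (INR l * h)) (2 * m)).
  { destruct m as [|m].
    - simpl. rewrite Rmult_0_l. lra.
    - apply Rlt_le, IH; [lia|lra]. }
  clear IH.
  assert (B := boole_pair_lower f (INR (2 * m) * h + h) h Hh).
  replace (2 * S m)%nat with (S (S (2 * m))) by lia.
  cbn [altsum]. rewrite !S_INR.
  replace ((-1) ^ S (2 * m)) with (-1) by (rewrite pow_1_odd; reflexivity).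
  rewrite pow_1_even.
  replace ((INR (2 * m) + 1 + 1) * h) with (INR (2 * m) * h + h + h) by ring.
  replace ((INR (2 * m) + 1) * h) with (INR (2 * m) * h + h) by ring.
  replace (INR (2 * m) * h + h - h) with (INR (2 * m) * h) in B by ring.
  assert (E : INR (2 * m) * h = 2 * (INR m * h)) by (rewrite mult_INR; simpl; ring).
  assert (B' := B ltac:(intros; apply Hf; [assumption|lra])
                  ltac:(intros; apply Hincr; lra)).
  lra.
Qed.

(** * The alternating harmonic sum against [ln 2] *)

Lemma ln_le_sub_1 (x : R) : 0 < x -> ln x <= x - 1.
Proof.
  intros Hx. destruct (Req_dec (ln x) 0) as [E|E].
  - assert (x = 1) by (rewrite <- (exp_ln x Hx), E; apply exp_0). lra.
  - assert (H := exp_ineq1 (ln x) E). rewrite exp_ln in H by exact Hx. lra.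
Qed.

(** [ln_le_sub_1] at [q / (q+1)] gives [1/(q+1) <= ln (q+1) - ln q], and the logarithms
    telescope. *)
Lemma harmonic_diff_le (p k : nat) : (0 < p)%nat ->
  sum_n_m (fun j => / INR j) (S p) (p + k) <= ln (INR (p + k)) - ln (INR p).
Proof.
  intros Hp. induction k as [|k IH].
  - rewrite Nat.add_0_r, sum_n_m_zero by lia. unfold zero; simpl. lra.
  - replace (p + S k)%nat with (S (p + k)) by lia.
    rewrite sum_n_Sm by lia. change (@plus R_AbelianMonoid) with Rplus.
    assert (H0 : 0 < INR (p + k)) by (apply lt_0_INR; lia).
    assert (H := ln_le_sub_1 (INR (p + k) / INR (S (p + k)))).
    rewrite S_INR in *.
    rewrite ln_div in H by lra.
    assert (0 < INR (p + k) / (INR (p + k) + 1)) by (apply Rdiv_lt_0_compat; lra).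
    replace (INR (p + k) / (INR (p + k) + 1) - 1) with (- / (INR (p + k) + 1)) in H by (field; lra).
    specialize (H ltac:(assumption)).
    eapply Rle_trans; [apply Rplus_le_compat_r, IH|]. lra.
Qed.

(** [ln_le_sub_1] at [(q+1) / q] gives [ln (q+1) - ln q <= 1/q], again telescoping. *)
Lemma harmonic_diff_ge (p k : nat) :
  ln (INR (S (p + k))) - ln (INR (S p)) <= sum_n_m (fun j => / INR j) (S p) (p + k).
Proof.
  induction k as [|k IH].
  - rewrite Nat.add_0_r, sum_n_m_zero by lia. unfold zero; simpl. lra.
  - replace (p + S k)%nat with (S (p + k)) by lia.
    rewrite sum_n_Sm by lia. change (@plus R_AbelianMonoid) with Rplus.
    assert (H0 : 0 < INR (S (p + k))) by (apply lt_0_INR; lia).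
    assert (H := ln_le_sub_1 (INR (S (S (p + k))) / INR (S (p + k)))).
    rewrite (S_INR (S (p + k))) in *.
    set (q := INR (S (p + k))) in *.
    rewrite ln_div in H by lra.
    assert (0 < (q + 1) / q) by (apply Rdiv_lt_0_compat; lra).
    replace ((q + 1) / q - 1) with (/ q) in H by (field; lra).
    specialize (H ltac:(assumption)).
    eapply Rle_trans; [|apply Rplus_le_compat_r, IH]. lra.
Qed.

(* The term [l = 0] of the alternating sum is [/ 0 = 0]. *)
Lemma altsum_inv (m : nat) : (0 < m)%nat ->
  - altsum (fun l => / INR l) (2 * m)
  = sum_n_m (fun j => / INR j) (S m) (m + m) + / (2 * INR m).
Proof.
  intros Hm. induction m as [|m IH]; [lia|].
  destruct m as [|m].
  - change (2 * 1)%nat with 2%nat. rewrite sum_n_n. simpl. rewrite Rinv_0. field.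
  - specialize (IH ltac:(lia)). set (k := S m) in *. assert (Hk : (0 < k)%nat) by lia. clearbody k.
    replace (2 * S k)%nat with (S (S (2 * k))) by lia.
    cbn [altsum].
    replace ((-1) ^ S (2 * k)) with (-1) by (rewrite pow_1_odd; reflexivity).
    rewrite pow_1_even.
    rewrite sum_Sn_m in IH by lia.
    replace (S k + S k)%nat with (S (S (k + k))) by lia.
    rewrite !sum_n_Sm by lia.
    change (@plus R_AbelianMonoid) with Rplus in *.
    assert (H0 : 0 < INR k) by (apply lt_0_INR; lia).
    rewrite !S_INR in *. rewrite plus_INR in *.
    replace (INR (2 * k)) with (2 * INR k) in * by (rewrite mult_INR; reflexivity).
    replace (altsum (fun l => / INR l) (2 * k))
      with (- (/ (INR k + 1) + sum_n_m (fun j => / INR j) (S (S k)) (k + k) + / (2 * INR k)))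
      by lra.
    set (s := sum_n_m _ _ _). field. lra.
Qed.

(** A crude bracket, serving only to identify the limit: the sum of [1/j] over [m < j <= 2m] is
    close to [ln (2m) - ln m]. *)
Lemma altsum_inv_near_ln2 (m : nat) : (0 < m)%nat ->
  ln 2 - / INR m <= - altsum (fun l => / INR l) (2 * m) <= ln 2 + / INR m.
Proof.
  intros Hm. rewrite altsum_inv by exact Hm.
  assert (H0 : 0 < INR m) by (apply lt_0_INR; lia).
  assert (U := harmonic_diff_le m m Hm). assert (L := harmonic_diff_ge m m).
  rewrite !S_INR, plus_INR in *.
  assert (A : ln (INR m + INR m) = ln 2 + ln (INR m)).
  { rewrite <- ln_mult by lra. f_equal. ring. }
  (* The lower harmonic bound [ln (2m+1) - ln (m+1)] misses [ln 2] by [ln ((2m+2)/(2m+1))]. *)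
  assert (B : ln 2 + ln (INR m + 1) - ln (INR m + INR m + 1) <= / (2 * INR m + 1)).
  { rewrite <- ln_mult, <- ln_div by nra.
    eapply Rle_trans; [apply ln_le_sub_1, Rdiv_lt_0_compat; lra|].
    apply Req_le. field. lra. }
  assert (C : / (2 * INR m + 1) < / INR m) by (apply Rinv_lt_contravar; nra).
  assert (D : / (2 * INR m) < / INR m) by (apply Rinv_lt_contravar; nra).
  assert (E : 0 < / (2 * INR m)) by (apply Rinv_0_lt_compat; lra).
  lra.
Qed.

Lemma is_lim_seq_inv_S : is_lim_seq (fun k => / INR (S k)) 0.
Proof.
  apply (is_lim_seq_incr_1 (fun k => / INR k)).
  apply (is_lim_seq_inv INR p_infty); [apply is_lim_seq_INR|discriminate].
Qed.

(** The corrections tend to [0] whatever [c] and [d] are, so one limit serves both sharp bounds. *)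
Lemma altsum_inv_lim (c d : R) :
  is_lim_seq (fun k => - altsum (fun l => / INR l) (2 * S k)
    - / (4 * INR (S k)) - c / INR (S k) ^ 2 + d / INR (S k) ^ 4) (ln 2).
Proof.
  assert (I := is_lim_seq_inv_S).
  assert (H : is_lim_seq (fun k => - altsum (fun l => / INR l) (2 * S k)) (ln 2)).
  { apply is_lim_seq_le_le with (fun k => ln 2 - / INR (S k)) (fun k => ln 2 + / INR (S k)).
    - intros k. apply altsum_inv_near_ln2. lia.
    - replace (Finite (ln 2)) with (Finite (ln 2 - 0)) by (f_equal; ring).
      apply is_lim_seq_minus'; [apply is_lim_seq_const|exact I].
    - replace (Finite (ln 2)) with (Finite (ln 2 + 0)) by (f_equal; ring).
      apply is_lim_seq_plus'; [apply is_lim_seq_const|exact I]. }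
  assert (I2 := is_lim_seq_mult' _ _ _ _ I I).
  assert (I4 := is_lim_seq_mult' _ _ _ _ I2 I2).
  assert (K := is_lim_seq_plus' _ _ _ _
    (is_lim_seq_minus' _ _ _ _
      (is_lim_seq_minus' _ _ _ _ H (is_lim_seq_mult' _ _ _ _ (is_lim_seq_const (/ 4)) I))
      (is_lim_seq_mult' _ _ _ _ (is_lim_seq_const c) I2))
    (is_lim_seq_mult' _ _ _ _ (is_lim_seq_const d) I4)).
  replace (ln 2 - / 4 * 0 - c * (0 * 0) + d * (0 * 0 * (0 * 0))) with (ln 2) in K by ring.
  eapply is_lim_seq_ext; [|exact K].
  intros k. cbn beta. set (A := altsum _ _).
  assert (0 < INR (S k)) by (apply lt_0_INR; lia).
  field. lra.
Qed.

Lemma altsum_inv_step (k : nat) :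
  - altsum (fun l => / INR l) (2 * S k)
  = - altsum (fun l => / INR l) (2 * k) - / (2 * INR k) + / (2 * INR k + 1).
Proof.
  replace (2 * S k)%nat with (S (S (2 * k))) by lia. cbn [altsum].
  replace ((-1) ^ S (2 * k)) with (-1) by (rewrite pow_1_odd; reflexivity).
  rewrite pow_1_even, S_INR.
  replace (INR (2 * k)) with (2 * INR k) by (rewrite mult_INR; reflexivity).
  lra.
Qed.

Lemma lt_lim_of_incr (u : nat -> R) (l : R) :
  (forall n, u n < u (S n)) -> is_lim_seq u l -> forall n, u n < l.
Proof.
  intros Hu Hl n. eapply Rlt_le_trans; [apply Hu|].
  apply (is_lim_seq_incr_compare u l Hl). intros k. now apply Rlt_le.
Qed.

(** The sum has the asymptotic expansion [ln 2 + 1/(4m) + 1/(16m^2) - 1/(128m^4) + ...]. Corrected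
    up to [1/(16m^2)], the sums increase strictly to [ln 2]. *)
Lemma altsum_inv_lt (m : nat) : (0 < m)%nat ->
  - altsum (fun l => / INR l) (2 * m) < ln 2 + / (4 * INR m) + / (16 * INR m ^ 2).
Proof.
  intros Hm. destruct m as [|m]; [lia|].
  assert (L := altsum_inv_lim (/ 16) 0).
  assert (H : forall k,
    - altsum (fun l => / INR l) (2 * S k)
    - / (4 * INR (S k)) - / 16 / INR (S k) ^ 2 + 0 / INR (S k) ^ 4
    < - altsum (fun l => / INR l) (2 * S (S k))
    - / (4 * INR (S (S k))) - / 16 / INR (S (S k)) ^ 2 + 0 / INR (S (S k)) ^ 4).
  { intros k. rewrite (altsum_inv_step (S k)). set (A := altsum _ _).
    rewrite (S_INR (S k)).
    assert (Hx : 0 < INR (S k)) by (apply lt_0_INR; lia). set (x := INR (S k)) in *.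
    apply Rlt_0_minus.
    (* The exact increment of the corrected sums, visibly positive. *)
    match goal with |- 0 < ?e => replace e with (/ (16 * x ^ 2 * (x + 1) ^ 2 * (2 * x + 1))) end.
    - apply Rinv_0_lt_compat. assert (0 < x ^ 2 * (x + 1) ^ 2) by (rewrite <- Rpow_mult_distr; apply pow_lt; nra). nra.
    - field. lra. }
  assert (Q := lt_lim_of_incr _ _ H L m). cbn beta in Q.
  assert (Hx : 0 < INR (S m)) by (apply lt_0_INR; lia).
  replace (/ (16 * INR (S m) ^ 2)) with (/ 16 / INR (S m) ^ 2) by (field; lra).
  unfold Rdiv in *. lra.
Qed.

(** One more term of the expansion reverses the monotonicity: the corrected sums now decrease
    strictly to [ln 2]. *)
Lemma altsum_inv_gt (m : nat) : (0 < m)%nat ->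
  ln 2 + / (4 * INR m) + / (16 * INR m ^ 2) - / (128 * INR m ^ 4)
  < - altsum (fun l => / INR l) (2 * m).
Proof.
  intros Hm. destruct m as [|m]; [lia|].
  assert (L := altsum_inv_lim (/ 16) (/ 128)).
  assert (H : forall k,
    - altsum (fun l => / INR l) (2 * S (S k))
    - / (4 * INR (S (S k))) - / 16 / INR (S (S k)) ^ 2 + / 128 / INR (S (S k)) ^ 4
    < - altsum (fun l => / INR l) (2 * S k)
    - / (4 * INR (S k)) - / 16 / INR (S k) ^ 2 + / 128 / INR (S k) ^ 4).
  { intros k. rewrite (altsum_inv_step (S k)). set (A := altsum _ _).
    rewrite (S_INR (S k)).
    assert (Hx : 0 < INR (S k)) by (apply lt_0_INR; lia). set (x := INR (S k)) in *.
    apply Rlt_0_minus.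
    match goal with |- 0 < ?e =>
      replace e with ((6 * x ^ 2 + 6 * x + 1) / (128 * x ^ 4 * (x + 1) ^ 4 * (2 * x + 1))) end.
    - apply Rdiv_lt_0_compat; [nra|].
      assert (0 < x ^ 4 * (x + 1) ^ 4) by (rewrite <- Rpow_mult_distr; apply pow_lt; nra). nra.
    - field. lra. }
  (* Negation makes the decreasing sequence increasing. *)
  assert (Q := lt_lim_of_incr
    (fun k => - (- altsum (fun l => / INR l) (2 * S k)
    - / (4 * INR (S k)) - / 16 / INR (S k) ^ 2 + / 128 / INR (S k) ^ 4)) (- ln 2)).
  cbn beta in Q.
  assert (Q' := Q (fun k => Ropp_lt_contravar _ _ (H k)) ltac:(apply is_lim_seq_opp in L; exact L) m).
  assert (Hx : 0 < INR (S m)) by (apply lt_0_INR; lia).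
  replace (/ (16 * INR (S m) ^ 2)) with (/ 16 / INR (S m) ^ 2) by (field; lra).
  replace (/ (128 * INR (S m) ^ 4)) with (/ 128 / INR (S m) ^ 4) by (field; lra).
  lra.
Qed.

(** * Boole's bounds for [tan] *)

(** Successive derivatives of [tan], obtained from [t' = 1 + t^2]; the last branch is the fifth. *)
Definition tan_deriv (k : nat) (x : R) : R :=
  let t := tan x in
  match k with
  | 0%nat => t
  | 1%nat => 1 + t ^ 2
  | 2%nat => 2 * t + 2 * t ^ 3
  | 3%nat => 2 + 8 * t ^ 2 + 6 * t ^ 4
  | 4%nat => 16 * t + 40 * t ^ 3 + 24 * t ^ 5
  | _ => 16 + 136 * t ^ 2 + 240 * t ^ 4 + 120 * t ^ 6
  end.

Lemma tan_deriv_correct (k : nat) (x : R) : (k < 5)%nat -> cos x <> 0 ->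
  is_derive (tan_deriv k) x (tan_deriv (S k) x).
Proof.
  intros Hk Hx.
  assert (H := is_derive_tan x Hx).
  do 5 (destruct k as [|k]; [
    unfold tan_deriv; auto_derive;
    [repeat split; now exists (tan x ^ 2 + 1)
    | erewrite (is_derive_unique (fun y => tan y)) by exact H; ring]|]).
  lia.
Qed.

Lemma tan_bounds (s t : R) : 0 <= s -> s < t -> t <= PI / 4 -> 0 <= tan s < tan t.
Proof.
  intros H0 Hst Ht. assert (HP := PI_RGT_0). split.
  - rewrite <- tan_0. apply tan_incr_1; lra.
  - apply tan_increasing; lra.
Qed.

(** The polynomial has positive coefficients, and [tan] is nonnegative and increasing on the
    interval. *)
Lemma tan_deriv3_increasing (s t : R) : 0 <= s -> s < t -> t <= PI / 4 ->
  tan_deriv 3 s < tan_deriv 3 t.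
Proof.
  intros H0 Hst Ht. destruct (tan_bounds s t H0 Hst Ht) as [A B].
  unfold tan_deriv.
  assert (C : tan s ^ 2 < tan t ^ 2) by nra.
  assert (D : tan s ^ 4 < tan t ^ 4) by nra.
  lra.
Qed.

Lemma tan_deriv5_increasing (s t : R) : 0 <= s -> s < t -> t <= PI / 4 ->
  tan_deriv 5 s < tan_deriv 5 t.
Proof.
  intros H0 Hst Ht. destruct (tan_bounds s t H0 Hst Ht) as [A B].
  unfold tan_deriv.
  assert (C : tan s ^ 2 < tan t ^ 2) by nra.
  assert (P : 0 <= tan s ^ 2) by nra.
  replace (tan s ^ 4) with (tan s ^ 2 * tan s ^ 2) by ring.
  replace (tan t ^ 4) with (tan t ^ 2 * tan t ^ 2) by ring.
  replace (tan s ^ 6) with ((tan s ^ 2 * tan s ^ 2) * tan s ^ 2) by ring.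
  replace (tan t ^ 6) with ((tan t ^ 2 * tan t ^ 2) * tan t ^ 2) by ring.
  set (p := tan s ^ 2) in *. set (q := tan t ^ 2) in *.
  assert (D : p * p < q * q) by nra.
  assert (E : p * p * p < q * q * q) by nra.
  lra.
Qed.

Lemma cos_pos_quarter (x : R) : 0 <= x <= PI / 4 -> cos x <> 0.
Proof.
  intros Hx. assert (HP := PI_RGT_0). apply Rgt_not_eq, cos_gt_0; lra.
Qed.

(** The range up to [PI / 4] suffices: the cotangent remainder is needed up to [PI / 2], and its
    halving identity evaluates [tan] at half the argument. *)
Lemma boole_tan_upper (h : R) (m : nat) : 0 < h -> (0 < m)%nat ->
  INR (2 * m) * h <= PI / 4 ->
  altsum (fun l => tan (INR l * h)) (2 * m)
  < (0 - tan (INR (2 * m) * h)) / 2 - h / 4 * (1 - tan_deriv 1 (INR (2 * m) * h)).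
Proof.
  intros Hh Hm Hb.
  assert (B := boole_upper tan_deriv h (PI / 4) m Hh Hm).
  rewrite mult_INR in Hb. simpl (INR 2) in Hb.
  specialize (B ltac:(lra)
    (fun k s Hk Hs => tan_deriv_correct k s Hk (cos_pos_quarter s Hs))
    tan_deriv3_increasing).
  unfold tan_deriv at 1 2 3 4 in B. rewrite tan_0 in B.
  replace (1 + 0 ^ 2) with 1 in B by ring. exact B.
Qed.

Lemma boole_tan_lower (h : R) (m : nat) : 0 < h -> (0 < m)%nat ->
  INR (2 * m) * h <= PI / 4 ->
  (0 - tan (INR (2 * m) * h)) / 2 - h / 4 * (1 - tan_deriv 1 (INR (2 * m) * h))
    + h ^ 3 / 48 * (2 - tan_deriv 3 (INR (2 * m) * h))
  < altsum (fun l => tan (INR l * h)) (2 * m).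
Proof.
  intros Hh Hm Hb.
  assert (B := boole_lower tan_deriv h (PI / 4) m Hh Hm).
  rewrite mult_INR in Hb. simpl (INR 2) in Hb.
  specialize (B ltac:(lra)
    (fun k s Hk Hs => tan_deriv_correct k s Hk (cos_pos_quarter s Hs))
    tan_deriv5_increasing).
  unfold tan_deriv in B |- *. rewrite tan_0 in B. lra.
Qed.

(** * The remainder [1/x - cot x]: halving identities and limits at [0] *)

Definition cot (x : R) : R := cos x / sin x.

(* [cotrem], [cotrem1] and [cotrem3] are [1/x - cot x] and its first and third
   derivatives away from [0]; since [/ 0 = 0], only [cotrem] has the right
   value at [0]. *)
Definition cotrem (x : R) : R := / x - cot x.
Definition cotrem1 (x : R) : R := 1 + cot x ^ 2 - / x ^ 2.
Definition cotrem3 (x : R) : R := 2 + 8 * cot x ^ 2 + 6 * cot x ^ 4 - 6 / x ^ 4.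

Lemma cot_0 : cot 0 = 0.
Proof. unfold cot. rewrite sin_0. unfold Rdiv. rewrite Rinv_0. ring. Qed.

Lemma cotrem_0 : cotrem 0 = 0.
Proof. unfold cotrem. rewrite cot_0, Rinv_0. ring. Qed.

Lemma half_angle_trig (x : R) : 0 < x < PI ->
  0 < cos (x / 2) /\ 0 < sin (x / 2) /\
  cos x = cos (x / 2) ^ 2 - sin (x / 2) ^ 2 /\ sin x = 2 * sin (x / 2) * cos (x / 2).
Proof.
  intros Hx. split; [apply cos_gt_0; lra|]. split; [apply sin_gt_0; lra|].
  split.
  - replace x with (2 * (x / 2)) at 1 by field. rewrite cos_2a. ring.
  - replace x with (2 * (x / 2)) at 1 by field. apply sin_2a.
Qed.

Lemma cot_half (x : R) : 0 < x < PI -> cot x = / 2 * (cot (x / 2) - tan (x / 2)).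
Proof.
  intros Hx. destruct (half_angle_trig x Hx) as (Hc & Hs & Ec & Es).
  unfold cot, tan. rewrite Ec, Es. field. lra.
Qed.

Lemma cot_mul_tan (x : R) : 0 < x < PI / 2 -> cot x * tan x = 1.
Proof.
  intros Hx. unfold cot, tan.
  assert (0 < cos x) by (apply cos_gt_0; lra).
  assert (0 < sin x) by (apply sin_gt_0; lra).
  field. lra.
Qed.

Lemma cotrem_half (x : R) : 0 <= x < PI ->
  cotrem x = / 2 * cotrem (x / 2) + / 2 * tan (x / 2).
Proof.
  intros [[Hx | <-] H].
  - unfold cotrem. rewrite cot_half by lra. field. lra.
  - replace (0 / 2) with 0 by field. rewrite cotrem_0, tan_0. ring.
Qed.

(** The derivative of the identity [cotrem_half], verified algebraically through [cot * tan = 1]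
    rather than by differentiating. *)
Lemma cotrem1_half (x : R) : 0 < x < PI ->
  cotrem1 x = / 4 * cotrem1 (x / 2) + / 4 * tan_deriv 1 (x / 2).
Proof.
  intros Hx. unfold cotrem1, tan_deriv. rewrite cot_half by lra.
  assert (E := cot_mul_tan (x / 2) ltac:(lra)).
  set (c := cot (x / 2)) in *. set (t := tan (x / 2)) in *.
  replace ((/ 2 * (c - t)) ^ 2) with (/ 4 * (c ^ 2 + t ^ 2 - 2 * (c * t))) by field.
  rewrite E. field. lra.
Qed.

Lemma cotrem3_half (x : R) : 0 < x < PI ->
  cotrem3 x = / 16 * cotrem3 (x / 2) + / 16 * tan_deriv 3 (x / 2).
Proof.
  intros Hx. unfold cotrem3, tan_deriv. rewrite cot_half by lra.
  assert (E := cot_mul_tan (x / 2) ltac:(lra)).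
  set (c := cot (x / 2)) in *. set (t := tan (x / 2)) in *.
  replace ((/ 2 * (c - t)) ^ 2) with (/ 4 * (c ^ 2 + t ^ 2 - 2 * (c * t))) by field.
  replace ((/ 2 * (c - t)) ^ 4) with
    (/ 16 * (c ^ 4 + t ^ 4 - 4 * (c * t) * (c ^ 2 + t ^ 2) + 6 * (c * t) ^ 2)) by field.
  rewrite E. field. lra.
Qed.

(* The sequence [h / 2^k * e (h / 2^k)] is strictly increasing with limit [0]. *)
Lemma neg_of_halving (e : R -> R) (h : R) :
  (forall k, e (h / 2 ^ k) < / 2 * e (h / 2 ^ k / 2)) ->
  is_lim_seq (fun k => h / 2 ^ k * e (h / 2 ^ k)) 0 ->
  0 < h -> e h < 0.
Proof.
  intros He Hl Hh.
  assert (Q : h / 2 ^ 0 * e (h / 2 ^ 0) < 0).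
  { refine (lt_lim_of_incr (fun k => h / 2 ^ k * e (h / 2 ^ k)) 0 _ Hl 0%nat).
    intros k. assert (P := pow_lt 2 k ltac:(lra)).
    replace (h / 2 ^ S k) with (h / 2 ^ k / 2) by (simpl; field; lra).
    replace (h / 2 ^ k / 2 * e (h / 2 ^ k / 2))
      with (h / 2 ^ k * (/ 2 * e (h / 2 ^ k / 2))) by (field; lra).
    apply Rmult_lt_compat_l; [apply Rdiv_lt_0_compat; lra|apply He]. }
  replace (h / 2 ^ 0) with h in Q by (simpl; field). nra.
Qed.

Lemma x_cot_lim (u : nat -> R) : (forall k, u k <> 0) -> is_lim_seq u 0 ->
  is_lim_seq (fun k => u k * cot (u k)) 1.
Proof.
  intros Hu Hl.
  assert (A : is_lim_seq (fun k => sin (u k) / u k) 1).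
  { apply (is_lim_comp_seq (fun x => sin x / x) u 0 1 is_lim_sinc_0); [|exact Hl].
    exists 0%nat. intros k _ E. apply (Hu k). now injection E. }
  assert (B : is_lim_seq (fun k => cos (u k)) 1).
  { rewrite <- cos_0. apply is_lim_seq_continuous; [apply continuity_cos|exact Hl]. }
  assert (C := is_lim_seq_div' _ _ _ _ B A ltac:(lra)).
  replace (1 / 1) with 1 in C by field.
  eapply is_lim_seq_ext; [|exact C]. intros k. cbn beta. unfold cot.
  unfold Rdiv. rewrite Rinv_mult, Rinv_inv. ring.
Qed.

(** The powers of [x] clear the poles: each product is a polynomial in [x] and [x cot x], which tend
    to [0] and [1]. No Taylor expansion of [cot] is required. *)
Lemma cotrem_lim (u : nat -> R) : (forall k, u k <> 0) -> is_lim_seq u 0 ->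
  is_lim_seq (fun k => u k * cotrem (u k)) 0 /\
  is_lim_seq (fun k => u k ^ 2 * cotrem1 (u k)) 0 /\
  is_lim_seq (fun k => u k ^ 4 * cotrem3 (u k)) 0.
Proof.
  intros Hu Hl. assert (C := x_cot_lim u Hu Hl).
  assert (U2 := is_lim_seq_mult' _ _ _ _ Hl Hl).
  assert (C2 := is_lim_seq_mult' _ _ _ _ C C).
  assert (U4 := is_lim_seq_mult' _ _ _ _ U2 U2).
  assert (C4 := is_lim_seq_mult' _ _ _ _ C2 C2).
  assert (K := is_lim_seq_const).
  repeat split.
  - assert (L := is_lim_seq_minus' _ _ _ _ (K 1) C).
    replace (1 - 1) with 0 in L by ring.
    eapply is_lim_seq_ext; [|exact L]. intros k. cbn beta. unfold cotrem. specialize (Hu k).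
    field. assumption.
  - assert (L := is_lim_seq_minus' _ _ _ _ (is_lim_seq_plus' _ _ _ _ U2 C2) (K 1)).
    replace (0 * 0 + 1 * 1 - 1) with 0 in L by ring.
    eapply is_lim_seq_ext; [|exact L]. intros k. cbn beta. unfold cotrem1. specialize (Hu k).
    field. assumption.
  - assert (L := is_lim_seq_plus' _ _ _ _
      (is_lim_seq_plus' _ _ _ _
        (is_lim_seq_mult' _ _ _ _ (K 2) U4)
        (is_lim_seq_mult' _ _ _ _ (K 8) (is_lim_seq_mult' _ _ _ _ U2 C2)))
      (is_lim_seq_mult' _ _ _ _ (K 6) (is_lim_seq_minus' _ _ _ _ C4 (K 1)))).
    replace (2 * (0 * 0 * (0 * 0)) + 8 * (0 * 0 * (1 * 1)) + 6 * (1 * 1 * (1 * 1) - 1))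
      with 0 in L by ring.
    eapply is_lim_seq_ext; [|exact L]. intros k. cbn beta. unfold cotrem3. specialize (Hu k).
    field. assumption.
Qed.

(** * The sign of the Boole error for [cotrem] *)

Lemma altsum_lim (a : nat -> R) (u : nat -> nat -> R) (n : nat) :
  (forall l, is_lim_seq (fun k => a k * u l k) 0) ->
  is_lim_seq (fun k => a k * altsum (fun l => u l k) n) 0.
Proof.
  intros H. induction n as [|n IH]; simpl.
  - eapply is_lim_seq_ext; [|apply is_lim_seq_const]. intros k. cbn beta. ring.
  - assert (L := is_lim_seq_plus' _ _ _ _ IH
      (is_lim_seq_mult' _ _ _ _ (is_lim_seq_const ((-1) ^ n)) (H n))).
    replace (0 + (-1) ^ n * 0) with 0 in L by ring.
    eapply is_lim_seq_ext; [|exact L]. intros k. cbn beta. ring.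
Qed.

(* The constants [1/3] and [2/15] here and in [boole_corr] are the first and third
   derivatives of [1/x - cot x] at [0]. *)
Definition boole_err (n : nat) (x : R) : R :=
  altsum (fun l => cotrem (INR l * x)) n + / 2 * cotrem (INR n * x)
  + x / 4 * (/ 3 - cotrem1 (INR n * x)).

Definition boole_corr (n : nat) (x : R) : R :=
  x ^ 3 / 48 * (2 / 15 - cotrem3 (INR n * x)).

(** The second bracket is the error of [boole_tan_upper] with step [x / 2]. The constants match
    because [c = 1/3] solves [c = (c + 1) / 4]. *)
Lemma boole_err_half (n : nat) (x : R) : (0 < n)%nat -> 0 < x -> INR n * x < PI ->
  boole_err n x = / 2 * boole_err n (x / 2)
  + / 2 * (altsum (fun l => tan (INR l * (x / 2))) n + tan (INR n * (x / 2)) / 2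
           + x / 2 / 4 * (1 - tan_deriv 1 (INR n * (x / 2)))).
Proof.
  intros Hn Hx Hb. unfold boole_err.
  assert (0 < INR n) by (apply lt_0_INR; exact Hn).
  assert (0 < INR n * x) by nra.
  rewrite cotrem_half, cotrem1_half by lra.
  rewrite (altsum_ext _ (fun l => / 2 * cotrem (INR l * (x / 2)) + / 2 * tan (INR l * (x / 2)))).
  - rewrite altsum_linear.
    replace (INR n * x / 2) with (INR n * (x / 2)) by field. field.
  - intros l Hl.
    replace (INR l * (x / 2)) with (INR l * x / 2) by field.
    apply cotrem_half.
    assert (0 <= INR l) by apply pos_INR.
    assert (INR l < INR n) by (apply lt_INR; exact Hl). nra.
Qed.

(** Here the constants match because [c = 2/15] solves [c = (c + 2) / 16]. *)
Lemma boole_corr_half (n : nat) (x : R) : (0 < n)%nat -> 0 < x -> INR n * x < PI ->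
  boole_corr n x = / 2 * boole_corr n (x / 2)
  + / 2 * ((x / 2) ^ 3 / 48 * (2 - tan_deriv 3 (INR n * (x / 2)))).
Proof.
  intros Hn Hx Hb. unfold boole_corr.
  assert (0 < INR n) by (apply lt_0_INR; exact Hn).
  rewrite cotrem3_half by nra.
  replace (INR n * x / 2) with (INR n * (x / 2)) by field. field.
Qed.

Lemma boole_err_lim (n : nat) (u : nat -> R) : (0 < n)%nat ->
  (forall k, u k <> 0) -> is_lim_seq u 0 ->
  is_lim_seq (fun k => u k * boole_err n (u k)) 0 /\
  is_lim_seq (fun k => u k * boole_corr n (u k)) 0.
Proof.
  intros Hn Hu Hl.
  assert (S : forall l, (0 < l)%nat ->
    INR l <> 0 /\ (forall k, INR l * u k <> 0) /\ is_lim_seq (fun k => INR l * u k) 0).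
  { intros l Hlp. assert (INR l <> 0) by (apply not_0_INR; lia). split; [assumption|]. split.
    - intros k. apply Rmult_integral_contrapositive_currified; [assumption|apply Hu].
    - replace (Finite 0) with (Finite (INR l * 0)) by (f_equal; ring).
      apply is_lim_seq_mult'; [apply is_lim_seq_const|exact Hl]. }
  assert (A : forall l, is_lim_seq (fun k => u k * cotrem (INR l * u k)) 0).
  { intros l. destruct l as [|l].
    - eapply is_lim_seq_ext; [|apply (is_lim_seq_const 0)]. intros k. cbn beta.
      simpl. rewrite Rmult_0_l, cotrem_0. ring.
    - destruct (S (Datatypes.S l) ltac:(lia)) as (N0 & N & L).
      destruct (cotrem_lim _ N L) as [L1 _].
      assert (Q := is_lim_seq_mult' _ _ _ _ (is_lim_seq_const (/ INR (Datatypes.S l))) L1).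
      rewrite Rmult_0_r in Q.
      eapply is_lim_seq_ext; [|exact Q]. intros k. cbn beta. set (c := cotrem _). field. exact N0. }
  destruct (S n Hn) as (N0 & N & L). destruct (cotrem_lim _ N L) as (_ & L1 & L3).
  assert (K := is_lim_seq_const).
  assert (U2 := is_lim_seq_mult' _ _ _ _ Hl Hl).
  split.
  - assert (Q := is_lim_seq_plus' _ _ _ _
      (is_lim_seq_plus' _ _ _ _
        (altsum_lim u (fun l k => cotrem (INR l * u k)) n A)
        (is_lim_seq_mult' _ _ _ _ (K (/ 2)) (A n)))
      (* [u * (u/4) * (1/3 - cotrem1 (n u))], rewritten with [(n u)^2 * cotrem1 (n u)]. *)
      (is_lim_seq_minus' _ _ _ _
        (is_lim_seq_mult' _ _ _ _ (K (/ 12)) U2)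
        (is_lim_seq_mult' _ _ _ _ (K (/ (4 * INR n ^ 2))) L1))).
    match type of Q with is_lim_seq _ (Finite ?v) => replace v with 0 in Q by ring end.
    eapply is_lim_seq_ext; [|exact Q]. intros k. cbn beta. unfold boole_err.
    set (c := altsum _ _). set (d := cotrem1 _). field. exact N0.
  - assert (Q := is_lim_seq_minus' _ _ _ _
        (is_lim_seq_mult' _ _ _ _ (K (/ 360)) (is_lim_seq_mult' _ _ _ _ U2 U2))
        (is_lim_seq_mult' _ _ _ _ (K (/ (48 * INR n ^ 4))) L3)).
    match type of Q with is_lim_seq _ (Finite ?v) => replace v with 0 in Q by ring end.
    eapply is_lim_seq_ext; [|exact Q]. intros k. cbn beta. unfold boole_corr.
    set (d := cotrem3 _). field. exact N0.
Qed.

Lemma dyadic_lim (h : R) : is_lim_seq (fun k => h / 2 ^ k) 0.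
Proof.
  assert (Q := is_lim_seq_mult' _ _ _ _ (is_lim_seq_const h)
    (is_lim_seq_geom (/ 2) ltac:(rewrite Rabs_pos_eq; lra))).
  rewrite Rmult_0_r in Q. eapply is_lim_seq_ext; [|exact Q]. intros k. cbn beta.
  rewrite pow_inv. reflexivity.
Qed.

Lemma dyadic_bounds (h : R) (k : nat) : 0 < h -> 0 < h / 2 ^ k <= h.
Proof.
  intros Hh. assert (1 <= 2 ^ k) by (apply pow_R1_Rle; lra). split.
  - apply Rdiv_lt_0_compat; lra.
  - apply Rle_div_l; nra.
Qed.

Lemma boole_err_neg (m : nat) (h : R) : (0 < m)%nat -> 0 < h ->
  INR (2 * m) * h <= PI / 2 -> boole_err (2 * m) h < 0.
Proof.
  intros Hm Hh Hb. assert (HP := PI_RGT_0).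
  assert (HN : 0 < INR (2 * m)) by (apply lt_0_INR; lia).
  apply neg_of_halving; [| |exact Hh].
  - intros k. destruct (dyadic_bounds h k Hh) as [X0 X1]. set (x := h / 2 ^ k) in *.
    assert (INR (2 * m) * x <= INR (2 * m) * h) by (apply Rmult_le_compat_l; lra).
    rewrite boole_err_half by (lia || lra).
    assert (B := boole_tan_upper (x / 2) m ltac:(lra) Hm ltac:(lra)). lra.
  - apply (boole_err_lim (2 * m) (fun k => h / 2 ^ k)); [lia| |apply dyadic_lim].
    intros k. apply Rgt_not_eq, dyadic_bounds, Hh.
Qed.

(** The halving argument applied to [boole_corr - boole_err], with [boole_tan_lower] giving the
    strict inequality. *)
Lemma boole_err_gt_corr (m : nat) (h : R) : (0 < m)%nat -> 0 < h ->
  INR (2 * m) * h <= PI / 2 -> boole_corr (2 * m) h < boole_err (2 * m) h.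
Proof.
  intros Hm Hh Hb. assert (HP := PI_RGT_0).
  assert (HN : 0 < INR (2 * m)) by (apply lt_0_INR; lia).
  enough (boole_corr (2 * m) h - boole_err (2 * m) h < 0) by lra.
  apply (neg_of_halving (fun x => boole_corr (2 * m) x - boole_err (2 * m) x)); [| |exact Hh].
  - intros k. destruct (dyadic_bounds h k Hh) as [X0 X1]. set (x := h / 2 ^ k) in *.
    assert (INR (2 * m) * x <= INR (2 * m) * h) by (apply Rmult_le_compat_l; lra).
    rewrite boole_err_half, boole_corr_half by (lia || lra).
    assert (B := boole_tan_lower (x / 2) m ltac:(lra) Hm ltac:(lra)). lra.
  - destruct (boole_err_lim (2 * m) (fun k => h / 2 ^ k)) as [L1 L2]; [lia| |apply dyadic_lim|].
    { intros k. apply Rgt_not_eq, dyadic_bounds, Hh. }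
    assert (Q := is_lim_seq_minus' _ _ _ _ L2 L1). rewrite Rminus_diag in Q.
    eapply is_lim_seq_ext; [|exact Q]. intros k. cbn beta. ring.
Qed.

(** * Reduction of the cosecant sum *)

Lemma csc_0 : csc 0 = 0.
Proof. unfold csc. rewrite sin_0. apply Rinv_0. Qed.

Lemma alternating_csc_sum_altsum (n : nat) : (0 < n)%nat ->
  alternating_csc_sum n = - altsum (fun l => csc (PI * INR l / INR n)) n.
Proof.
  intros Hn. unfold alternating_csc_sum.
  assert (E : forall f k, f 0%nat = 0 ->
    sum_n_m (fun l : nat => (-1) ^ (l + 1) * f l) 1 k = - altsum f (S k)).
  { intros f k Hf. induction k as [|k IH].
    - rewrite sum_n_m_zero by lia. simpl. rewrite Hf. unfold zero; simpl. ring.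
    - rewrite sum_n_Sm, IH by lia. change (@plus R_AbelianMonoid) with Rplus.
      rewrite pow_add. cbn [altsum].
      match goal with |- ?a = ?b => change (@eq R a b) end. ring. }
  rewrite (E (fun l => csc (PI * INR l / INR n))).
  - f_equal. f_equal. lia.
  - simpl. rewrite Rmult_0_r. unfold Rdiv. rewrite Rmult_0_l. apply csc_0.
Qed.

(** The reflection [l -> n - l] preserves the cosecant and, for odd [n], flips the sign. The end
    value [csc PI] is [0] by default. *)
Lemma alternating_csc_sum_odd (n : nat) : Nat.Odd n -> alternating_csc_sum n = 0.
Proof.
  intros [m ->]. set (n := (2 * m + 1)%nat).
  assert (Hn : INR n <> 0) by (apply not_0_INR; lia).
  rewrite alternating_csc_sum_altsum by lia.
  apply Ropp_eq_0_compat, altsum_antisym.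
  - replace (PI * INR n / INR n) with PI by (field; assumption).
    unfold csc. rewrite sin_PI. apply Rinv_0.
  - intros l Hl. unfold n at 1. rewrite Nat.add_1_r, pow_1_odd, minus_INR by exact Hl.
    replace (PI * (INR n - INR l) / INR n) with (PI - PI * INR l / INR n)
      by (field; assumption).
    unfold csc. rewrite sin_PI_x. ring.
Qed.

Lemma altsum_cot_even (m : nat) : (0 < m)%nat ->
  altsum (fun l => cot (PI * INR l / INR (2 * m))) (2 * m) = 0.
Proof.
  intros Hm. set (n := (2 * m)%nat).
  assert (Hn : INR n <> 0) by (apply not_0_INR; lia).
  apply altsum_antisym.
  - replace (PI * INR n / INR n) with PI by (field; assumption).
    unfold cot. rewrite sin_PI. unfold Rdiv. rewrite Rinv_0. ring.
  - intros l Hl. unfold n at 1. rewrite pow_1_even, minus_INR by exact Hl.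
    replace (PI * (INR n - INR l) / INR n) with (PI - PI * INR l / INR n)
      by (field; assumption).
    unfold cot. rewrite sin_PI_x, Rtrigo_facts.cos_pi_minus. unfold Rdiv. ring.
Qed.

(** At [x = 0] both sides are default values [0], so the term [l = 0] needs no separate
    treatment. *)
Lemma csc_cot (x : R) : 0 <= x < PI -> csc x = cot (x / 2) - cot x.
Proof.
  intros [[Hx | <-] H].
  - destruct (half_angle_trig x ltac:(lra)) as (Hc & Hs & Ec & Es).
    assert (E := sin2_cos2 (x / 2)). unfold Rsqr in E.
    unfold csc, cot. rewrite Ec, Es. field_simplify_eq; [|lra]. nra.
  - replace (0 / 2) with 0 by field. rewrite csc_0. ring.
Qed.

(** Each term is [cot (l h) - cot (2 l h)]; the second part sums to [0] by [altsum_cot_even], and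
    the first splits as [1/(l h) - cotrem (l h)]. *)
Lemma alternating_csc_sum_even (m : nat) : (0 < m)%nat ->
  let h := PI / (2 * INR (2 * m)) in
  alternating_csc_sum (2 * m)
  = / h * - altsum (fun l => / INR l) (2 * m)
    + altsum (fun l => cotrem (INR l * h)) (2 * m).
Proof.
  intros Hm h. assert (HP := PI_RGT_0).
  assert (HN : 0 < INR (2 * m)) by (apply lt_0_INR; lia).
  rewrite alternating_csc_sum_altsum by lia.
  rewrite (altsum_ext _ (fun l =>
    1 * (/ h * / INR l + (-1) * cotrem (INR l * h)) + (-1) * cot (PI * INR l / INR (2 * m)))).
  - rewrite (altsum_linear 1 (-1) (fun l => / h * / INR l + -1 * cotrem (INR l * h))
      (fun l => cot (PI * INR l / INR (2 * m)))).
    rewrite altsum_linear, altsum_cot_even by exact Hm. ring.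
  - intros l Hl.
    assert (0 <= INR l) by apply pos_INR.
    assert (INR l < INR (2 * m)) by (apply lt_INR; exact Hl).
    rewrite csc_cot.
    + replace (PI * INR l / INR (2 * m) / 2) with (INR l * h) by (unfold h; field; lra).
      unfold cotrem. rewrite Rinv_mult. ring.
    + split.
      * apply Rcomplements.Rdiv_le_0_compat; nra.
      * apply Rlt_div_l; nra.
Qed.

(** * Collecting the explicit bounds *)

Lemma cot_PI2 : cot (PI / 2) = 0.
Proof. unfold cot. rewrite cos_PI2. unfold Rdiv. ring. Qed.

Theorem corollary3 :
  (forall n : nat, (2 <= n)%nat -> Nat.Even n ->
     2 * INR n * ln 2 / PI + PI / (12 * INR n)
       - 7 * PI ^ 3 / (1440 * INR n ^ 3)
     < alternating_csc_sum n
     /\ alternating_csc_sum n < 2 * INR n * ln 2 / PI + PI / (12 * INR n))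
  /\
  (forall n : nat, (3 <= n)%nat -> Nat.Odd n -> alternating_csc_sum n = 0).
Proof.
  split; [|intros n _; apply alternating_csc_sum_odd].
  intros n Hn [m ->]. assert (Hm : (0 < m)%nat) by lia.
  assert (HP := PI_RGT_0).
  assert (HM : 0 < INR m) by (apply lt_0_INR; exact Hm).
  assert (HE : INR (2 * m) = 2 * INR m) by (rewrite mult_INR; reflexivity).
  rewrite alternating_csc_sum_even by exact Hm.
  set (h := PI / (2 * INR (2 * m))).
  assert (Hh : 0 < h) by (apply Rdiv_lt_0_compat; lra).
  assert (Hend : INR (2 * m) * h = PI / 2) by (unfold h; field; lra).
  assert (Up := boole_err_neg m h Hm Hh ltac:(lra)).
  assert (Lo := boole_err_gt_corr m h Hm Hh ltac:(lra)).
  assert (Hi : 0 < / h) by (apply Rinv_0_lt_compat; exact Hh).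
  assert (HU := Rmult_lt_compat_l _ _ _ Hi (altsum_inv_lt m Hm)).
  assert (HL := Rmult_lt_compat_l _ _ _ Hi (altsum_inv_gt m Hm)).
  unfold boole_corr, boole_err in Up, Lo.
  set (A := / h * - altsum (fun l => / INR l) (2 * m)) in *.
  set (B := altsum (fun l => cotrem (INR l * h)) (2 * m)) in *.
  clearbody A B.
  unfold cotrem, cotrem1, cotrem3 in Up, Lo. rewrite Hend, cot_PI2 in Up, Lo.
  (* [e] is the endpoint part of the Boole error, so [Up] says [B + e < 0]. In [EU] the powers of
     [2/PI] in [e] cancel [1/(4m)] and [1/(16m^2)] in [u], and [h/6 = PI/(12n)] remains. *)
  set (e := / 2 * (/ (PI / 2) - 0) + h / 4 * (/ 3 - (1 + 0 ^ 2 - / (PI / 2) ^ 2))).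
  set (u := ln 2 + / (4 * INR m) + / (16 * INR m ^ 2)) in *.
  assert (EU : / h * u - e = 2 * INR (2 * m) * ln 2 / PI + PI / (12 * INR (2 * m))).
  { unfold e, u, h. rewrite HE. field. lra. }
  (* Likewise [6 / (PI/2)^4] cancels the [1/(128m^4)] correction, and [2/15 - 2 = -28/15] yields the
     coefficient [7/1440]. *)
  assert (EL : h ^ 3 / 48 * (2 / 15 - (2 + 8 * 0 ^ 2 + 6 * 0 ^ 4 - 6 / (PI / 2) ^ 4))
      - / h * / (128 * INR m ^ 4) = - (7 * PI ^ 3 / (1440 * INR (2 * m) ^ 3))).
  { unfold h. rewrite HE. field. lra. }
  split; unfold e in EU; lra.
Qed.
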